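(* Let $\mathcal{G}$ be a generalised quadrangle of order $(s,s^2)$, let $P$ be a point of $\mathcal{G}$ and let $\infty=P^\perp$. If $\mathcal{I}$ is an $m$-ovoid of $\mathcal{G}$ with $0<m<s+1$ and $\mathcal{I}\setminus\infty$ is an intriguing set of the partial quadrangle $\mathcal{G}\setminus\infty$, then $\mathcal{I}$ is a hemisystem of $\mathcal{G}$, i.e. $m=(s+1)/2$.
   Context: A generalised quadrangle of order $(s,t)$ is a point-line incidence structure in which two distinct points are on at most one line, every line has $s+1$ points, every point is on $t+1$ lines, and for every point $X$ not on a line $\ell$ there is exactly one point of $\ell$ collinear with $X$; here $s\ge2$. $P^\perp$ is the set of all points collinear with $P$, including $P$. An $m$-ovoid is a set of points meeting every line in exactly $m$ points; a hemisystem is an $m$-ovoid with $m=(s+1)/2$. $\mathcal{G}\setminus P^\perp$ denotes the geometry whose points are the points of $\mathcal{G}$ not collinear with $P$ and whose lines are the lines of $\mathcal{G}$ not through $P$. For $\mathcal{G}$ of order $(s,s^2)$ it is a partial quadrangle $\mathsf{PQ}(s-1,s^2,s(s-1))$: lines have $s$ points, points are on $s^2+1$ lines, for each non-incident point-line pair at most one point of the line is collinear with the point, and two non-collinear points have exactly $s(s-1)$ points collinear with both. A nonempty proper subset $\mathcal{J}$ of the points of a partial quadrangle is an intriguing set with parameters $(h_1,h_2)$ if the number of points of $\mathcal{J}$ collinear with and distinct from a point $X$ is $h_1$ if $X\in\mathcal{J}$ and $h_2$ if $X\notin\mathcal{J}$. *)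

(* Defs.v *)
From mathcomp Require Import all_boot.

Set Implicit Arguments.
Unset Strict Implicit.
Unset Printing Implicit Defensive.

Record incidence := Incidence {
  point : finType;
  line : finType;
  inc : point -> line -> bool
}.

Definition points_on (G : incidence) (l : line G) : {set point G} :=
  [set X | inc X l].

Definition lines_on (G : incidence) (X : point G) : {set line G} :=
  [set l | inc X l].

Definition collinear (G : incidence) : rel (point G) :=
  fun X Y => [exists l : line G, inc X l && inc Y l].

Definition perp (G : incidence) (P : point G) : {set point G} :=
  P |: [set X | collinear P X].

Record generalised_quadrangle (G : incidence) (s t : nat) : Prop := {
  gq_partial_linear : forall X Y : point G, X != Y ->
    #|lines_on X :&: lines_on Y| <= 1;
  gq_line_size : forall l : line G, #|points_on l| = s.+1;
  gq_point_degree : forall X : point G, #|lines_on X| = t.+1;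
  gq_projection : forall (X : point G) (l : line G), ~~ inc X l ->
    exists! Y : point G, inc Y l /\ collinear X Y
}.

Definition m_ovoid (G : incidence) (m : nat) (I : {set point G}) : Prop :=
  forall l : line G, #|I :&: points_on l| = m.

(* m = (s + 1) / 2 is exact division, so s is odd. *)
Definition hemisystem (G : incidence) (s : nat) (I : {set point G}) : Prop :=
  exists2 m : nat, m.*2 = s.+1 & m_ovoid m I.

(* G \ P^perp: a line l of G not through P loses exactly its point in P^perp. *)
Definition remove_perp (G : incidence) (P : point G) : incidence :=
  @Incidence {X : point G | X \notin perp P} {l : line G | ~~ inc P l}
    (fun X l => inc (val X) (val l)).

(* I \ P^perp, as a set over the subtype of points of G \ P^perp. *)
Definition trace_perp (G : incidence) (P : point G) (I : {set point G}) :
    {set point (remove_perp P)} :=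
  [set X | val X \in I].

Definition intriguing_with (G : incidence) (J : {set point G})
    (h1 h2 : nat) : Prop :=
  [/\ J != set0, J \proper [set: point G] &
    forall X : point G,
      #|[set Y in J | (Y != X) && collinear X Y]| =
        if X \in J then h1 else h2].

Definition intriguing (G : incidence) (J : {set point G}) : Prop :=
  exists h1 h2 : nat, intriguing_with J h1 h2.

(* Main.v *)
Require Import Defs.
From mathcomp Require Import all_boot.
From mathcomp Require Import zify.

Set Implicit Arguments.
Unset Strict Implicit.
Unset Printing Implicit Defensive.

(** The proof rests on the rigidity of triads in a quadrangle of order
    [(s, s^2)]: three pairwise non-collinear points always have exactly [s + 1]
    common neighbours, called centres ([triad_centres]).  This is a vanishing
    variance.  Fix non-collinear [P], [Q] and let [X] run over the points
    collinear with neither; the number of centres of [P, Q, X] has its first two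
    moments determined by [s] and [t], and for [t = s^2] they leave room for no
    deviation from the mean [s + 1].

    Let [A] be an [m]-ovoid and let [P], [Q] be non-collinear points of [A].
    Put [C := perp P :&: perp Q] and count the collinear pairs [(X, Y)] with
    [Y] in [C] and [X] in [A], [X] collinear with neither [P] nor [Q].  Through
    [X] the count is [s + 1] times the number of such [X]; through [Y] each of
    the [t - 1] lines on [Y] avoiding [P] and [Q] contributes [m] or [m - 1].
    Both sides are affine in [k := #|A :&: C|], so [k] is forced:
    [k = m * (s + 1) - 2 * s] ([ovoid_centres_card]).

    Then keep [P] in [A] and sum [k] over all [Q] in [A] not collinear with [P].
    The same sum, taken through the points [Y] of [A] collinear with [P], is
    [(t + 1) * (m - 1) * t * (m - 1)].  With [t = s^2] the resulting equation is
    [(2 * m - (s + 1)) * (m - (s + 1)) = 0], so [m < s + 1] leaves only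
    [m = (s + 1) / 2] ([ovoid_eq_half]). *)

(** * Cardinality preliminaries *)

Lemma card_setI_sum (T : finType) (A B : {set T}) :
  #|A :&: B| = \sum_(x in A) (x \in B : nat).
Proof.
rewrite -sum1_card big_mkcond [RHS]big_mkcond; apply: eq_bigr => x _.
by rewrite inE; case: (x \in A); case: (x \in B).
Qed.

(** Inclusion-exclusion, arranged without truncated subtraction. *)
Lemma card_far2 (G : incidence) (P Q : point G) (A : {set point G}) :
  #|A :\: (perp P :|: perp Q)| + #|A :&: perp P| + #|A :&: perp Q|
  = #|A| + #|A :&: (perp P :&: perp Q)|.
Proof.
have := cardsUI (A :&: perp P) (A :&: perp Q).
have := cardsID (perp P :|: perp Q) A.
by rewrite -setIUr -setIIr; lia.
Qed.

(** * Counting in a generalised quadrangle of order (s, t) *)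

Section Quadrangle.

Variables (G : incidence) (s t : nat).
Hypothesis hG : generalised_quadrangle G s t.

Implicit Types (P Q X Y Z : point G) (l : line G) (A B C : {set point G}).

(** Every point lies on some line, so collinearity is reflexive and [perp X] is
    just the set of points sharing a line with [X]. *)
Lemma perpP X Y : reflect (exists2 l, inc X l & inc Y l) (Y \in perp X).
Proof.
rewrite !inE; apply: (iffP orP) => [[/eqP->|]|[l Xl Yl]].
- have /card_gt0P[l] : 0 < #|lines_on X| by rewrite (gq_point_degree hG).
  by rewrite inE => Xl; exists l.
- by case/existsP=> l /andP[Xl Yl]; exists l.
by right; apply/existsP; exists l; rewrite Xl.
Qed.

Lemma perp_refl X : X \in perp X.
Proof. by rewrite !inE eqxx. Qed.

Lemma perpC X Y : (X \in perp Y) = (Y \in perp X).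
Proof. by apply/perpP/perpP=> -[l ? ?]; exists l. Qed.

Lemma line_uniq X Y l l' :
  X != Y -> inc X l -> inc Y l -> inc X l' -> inc Y l' -> l = l'.
Proof.
move=> /(gq_partial_linear hG)/card_le1_eqP U Xl Yl Xl' Yl'.
by apply: U; rewrite !inE ?Xl ?Yl ?Xl' ?Yl'.
Qed.

Lemma projection_card X l : ~~ inc X l -> #|points_on l :&: perp X| = 1.
Proof.
case/(gq_projection hG)=> Y [[Yl XY] U].
apply/eqP/cards1P; exists Y; apply/setP=> Z; rewrite [RHS]inE.
apply/idP/eqP=> [|->]; last by rewrite !inE Yl XY orbT.
rewrite inE => /andP[]; rewrite inE => Zl /perpP[l' Xl' Zl'].
apply/esym/U; split=> //.
by apply/existsP; exists l'; rewrite Xl'.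
Qed.

Lemma projection_uniq X Y Z l : ~~ inc X l -> inc Y l -> inc Z l ->
  Y \in perp X -> Z \in perp X -> Y = Z.
Proof.
move=> Xl Yl Zl XY XZ.
have /eq_leq/card_le1_eqP U := projection_card Xl.
by apply: U; rewrite in_setI ?XY ?XZ inE ?Yl ?Zl.
Qed.

Lemma double_count B C :
  \sum_(Y in C) #|B :&: perp Y| = \sum_(X in B) #|C :&: perp X|.
Proof.
under eq_bigr do rewrite card_setI_sum.
rewrite exchange_big; apply: eq_bigr => X _; rewrite card_setI_sum.
by apply: eq_bigr => Y _; rewrite perpC.
Qed.

(** The lines on [Y] partition the points other than [Y] that are collinear
    with [Y]. *)
Lemma pencil B Y : Y \notin B ->
  #|B :&: perp Y| = \sum_(l in lines_on Y) #|B :&: points_on l|.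
Proof.
move=> YB.
under eq_bigr do rewrite card_setI_sum.
rewrite exchange_big card_setI_sum; apply: eq_bigr => X XB /=.
case XY: (X \in perp Y).
  have YX : Y != X by apply: contraNneq YB => ->.
  have [l Yl Xl] := perpP _ _ XY.
  rewrite (bigD1 l) !inE //= Xl big1 // => l' /andP[]; rewrite inE => Yl' nl.
  apply/eqP; rewrite inE eqb0; apply: contra nl => Xl'; apply/eqP.
  exact: (line_uniq YX).
rewrite big1 // => l; rewrite inE => Yl.
apply/eqP; rewrite inE eqb0; apply: contraFN XY => Xl.
by apply/perpP; exists l.
Qed.

(** Common form of the local counts below: [B] is the part of an [m]-ovoid [A]
    that avoids some configuration, and [D] is the set of lines on which that
    avoidance leaves nothing.  Any other line on [Y] keeps all its points of
    [A] except possibly [Y] itself. *)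
Lemma pencil_ovoid m A B Y (D : {set line G}) : m_ovoid m A -> Y \notin B ->
  (forall l X, inc Y l -> inc X l ->
     (X \in B) = [&& X \in A, X != Y & l \notin D]) ->
  #|B :&: perp Y| = #|lines_on Y :\: D| * (m - (Y \in A)).
Proof.
move=> hA YB hB; rewrite (pencil YB) (big_setID D) /= big1 ?add0n => [|l].
  rewrite -sum_nat_const; apply: eq_bigr => l; rewrite !inE => /andP[lD Yl].
  rewrite -(hA l) (cardsD1 Y (A :&: _)) !inE Yl andbT addKn.
  apply: eq_card => X; rewrite !inE; case Xl: (inc X l); rewrite ?andbF //.
  by rewrite (hB l) // lD !andbT andbC.
rewrite !inE => /andP[Yl lD]; apply: eq_card0 => X; rewrite !inE.
by case Xl: (inc X l); rewrite ?andbF // (hB l) // lD !andbF.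
Qed.

(** Makes every count over an [m]-ovoid also a count over all points. *)
Lemma points_ovoid : m_ovoid s.+1 [set: point G].
Proof. by move=> l; rewrite setTI (gq_line_size hG). Qed.

Lemma ovoid_perp_card m A P : m_ovoid m A ->
  #|A :&: perp P| = t.+1 * (m - (P \in A)) + (P \in A).
Proof.
move=> hA; rewrite (cardsD1 P) in_setI perp_refl andbT addnC; congr (_ + _).
have -> : (A :&: perp P) :\ P = (A :\ P) :&: perp P.
  by rewrite !setDE setIAC.
rewrite (pencil_ovoid (D := set0) hA) ?setD0 ?(gq_point_degree hG) //.
  by rewrite !inE eqxx.
by move=> l X _ _; rewrite !inE andbT andbC.
Qed.

(** Of the [t + 1] lines on [Y] only the line [YP] is lost; on the others [Y] is
    the unique point collinear with [P], there being no triangles. *)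
Lemma ovoid_far_card m A P Y : m_ovoid m A -> Y \in perp P -> Y != P ->
  #|(A :\: perp P) :&: perp Y| = t * (m - (Y \in A)).
Proof.
move=> hA YP nYP; rewrite (pencil_ovoid (D := lines_on P) hA).
- congr (_ * _); have [l Pl Yl] := perpP _ _ YP.
  rewrite cardsD (gq_point_degree hG).
  have -> : lines_on Y :&: lines_on P = [set l].
    apply/setP=> l'; rewrite !inE; apply/andP/eqP=> [[Yl' Pl']|-> //].
    exact: (line_uniq nYP).
  by rewrite cards1 subn1.
- by rewrite in_setD YP.
move=> l X Yl Xl; rewrite in_setD andbC [l \in _]inE; case: (X \in A) => //=.
apply/idP/andP=> [XP|[nXY]].
  split; first by apply: contraNneq XP => ->.
  by apply: contra XP => Pl; apply/perpP; exists l.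
by move=> Pl; apply: contraNN nXY => XP; apply/eqP/(projection_uniq Pl).
Qed.

Lemma ovoid_off_line_card m A l Y : m_ovoid m A -> inc Y l ->
  #|(A :\: points_on l) :&: perp Y| = t * (m - (Y \in A)).
Proof.
move=> hA Yl; rewrite (pencil_ovoid (D := [set l]) hA).
- congr (_ * _); have := cardsD1 l (lines_on Y).
  by rewrite inE Yl (gq_point_degree hG) add1n => -[].
- by rewrite !inE Yl.
move=> l' X Yl' Xl'; rewrite !inE andbC; case: (X \in A) => //=.
have [-> | nXY] := eqVneq X Y; first by rewrite Yl.
apply/idP/idP; first by apply: contraNneq => <-.
by apply: contraNN => Xl; apply/eqP/(line_uniq nXY).
Qed.

Lemma ovoid_gt0 m A X : m_ovoid m A -> X \in A -> 0 < m.
Proof.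
move=> hA XA; have /perpP[l Xl _] := perp_refl X.
by rewrite -(hA l); apply/card_gt0P; exists X; rewrite !inE XA.
Qed.

(** Sums a local count over [C]; the term in [A :&: C] is moved to the left so
    that the formula is affine in that cardinal. *)
Lemma sum_ovoid m A C c : m_ovoid m A ->
  \sum_(Y in C) c * (m - (Y \in A)) + c * #|A :&: C| = c * (#|C| * m).
Proof.
move=> hA; rewrite -big_distrr -mulnDr /=; congr (_ * _).
rewrite setIC card_setI_sum -big_split -sum_nat_const; apply: eq_bigr => Y _ /=.
case YA: (Y \in A); last by rewrite subn0 addn0.
by rewrite subnK // (ovoid_gt0 hA YA).
Qed.

(** Fix a line [l]: each point off [l] has one neighbour on [l], so the points
    of [A] off [l] are counted by the neighbours off [l] of the points of [l].
    The line is taken through [P]. *)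
Lemma ovoid_card m A P : m_ovoid m A -> #|A| = m * (s * t).+1.
Proof.
move=> hA; have /perpP[l _ _] := perp_refl P.
have E := double_count (A :\: points_on l) (points_on l).
rewrite [RHS](eq_bigr (fun=> 1)) ?sum1_card in E => [|X]; last first.
  by rewrite !inE => /andP[Xl _]; apply: projection_card.
have := sum_ovoid (points_on l) t hA.
rewrite hA (gq_line_size hG); under eq_bigr => Y.
  rewrite inE => Yl; rewrite -(ovoid_off_line_card hA Yl); over.
rewrite E => {}E.
by have := cardsID (points_on l) A; rewrite hA; nia.
Qed.

Section NonCollinear.

Variables (P Q : point G).
Hypothesis nPQ : P \notin perp Q.

Lemma centre_neq Y : Y \in perp P :&: perp Q -> (Y != P) * (Y != Q).
Proof.
rewrite inE => /andP[YP YQ]; split; apply: contraNneq nPQ => E.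
  by rewrite -E.
by rewrite perpC -E.
Qed.

(** Each line on [P] misses [Q], hence carries exactly one neighbour of [Q]. *)
Lemma centres_card : #|perp P :&: perp Q| = t.+1.
Proof.
rewrite setIC pencil ?(gq_point_degree hG) //.
rewrite -(gq_point_degree hG P) -sum1_card; apply: eq_bigr => l.
rewrite inE setIC => Pl; apply: projection_card; apply: contra nPQ => Ql.
by apply/perpP; exists l.
Qed.

(** A line joining two common neighbours [Y], [Z] would form a triangle with [P]
    unless [P] is on it, and likewise for [Q]; so it would join [P] and [Q]. *)
Lemma centres_noncollinear Y Z : Y \in perp P :&: perp Q ->
  Z \in perp P :&: perp Q -> Y != Z -> Y \notin perp Z.
Proof.
move=> YC ZC nYZ; apply: contra nPQ => /perpP[l Zl Yl].
move: YC ZC; rewrite !in_setI => /andP[YP YQ] /andP[ZP ZQ].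
have Pl : inc P l.
  by apply: contraNT nYZ => Pl; apply/eqP/(projection_uniq Pl).
have Ql : inc Q l.
  by apply: contraNT nYZ => Ql; apply/eqP/(projection_uniq Ql).
by apply/perpP; exists l.
Qed.

(** Now two of the lines on [Y] are lost, [YP] and [YQ], and they are distinct
    because [P] and [Q] are not collinear. *)
Lemma ovoid_far2_card m A Y : m_ovoid m A -> Y \in perp P :&: perp Q ->
  #|(A :\: (perp P :|: perp Q)) :&: perp Y| = t.-1 * (m - (Y \in A)).
Proof.
move=> hA YC; have [nYP nYQ] := centre_neq YC.
move: (YC); rewrite in_setI => /andP[YP YQ].
rewrite (pencil_ovoid (D := lines_on P :|: lines_on Q) hA).
- congr (_ * _).
  have [l Pl Yl] := perpP _ _ YP; have [l' Ql' Yl'] := perpP _ _ YQ.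
  rewrite cardsD (gq_point_degree hG).
  have -> : lines_on Y :&: (lines_on P :|: lines_on Q) = [set l; l'].
    apply/setP=> k; rewrite !inE; apply/andP/orP=> [[Yk /orP[Pk|Qk]]|].
    + by left; apply/eqP/(line_uniq nYP).
    + by right; apply/eqP/(line_uniq nYQ).
    by case=> /eqP->; rewrite ?Yl ?Yl' ?Pl ?Ql' ?orbT.
  rewrite cards2; have -> /= : l != l'.
    by apply: contraNneq nPQ => E; apply/perpP; exists l; rewrite // E.
  by rewrite subnS subn1.
- by rewrite in_setD in_setU YP.
move=> l X Yl Xl; rewrite in_setD andbC in_setU.
case: (X \in A) => //=; rewrite in_setU !negb_or [l \in lines_on P]inE.
rewrite [l \in lines_on Q]inE; apply/andP/and3P=> [[XP XQ]|[nXY Pl Ql]].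
  split; first by apply: contraNneq XP => ->.
    by apply: contra XP => Pl; apply/perpP; exists l.
  by apply: contra XQ => Ql; apply/perpP; exists l.
by split; apply/negP=> XPQ; case/eqP: nXY;
  [apply: (projection_uniq Pl)|apply: (projection_uniq Ql)].
Qed.

End NonCollinear.

(** The hypotheses are symmetric between the pairs [P, Q] and [Y, Z]: the
    [t + 1] common neighbours of [Y] and [Z] are [P], [Q] and points which, by
    [centres_noncollinear] applied to [Y, Z], are collinear with neither. *)
Lemma centres_far2_card P Q Y Z : P \notin perp Q ->
  Y \in perp P :&: perp Q -> Z \in perp P :&: perp Q -> Y != Z ->
  #|([set: point G] :\: (perp P :|: perp Q)) :&: perp Y :&: perp Z| = t.-1.
Proof.
move=> nPQ YC ZC nYZ; have hYZ := centres_noncollinear nPQ YC ZC nYZ.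
have := centres_card hYZ; move: YC ZC; rewrite !in_setI.
move=> /andP[YP YQ] /andP[ZP ZQ].
have PC : P \in perp Y :&: perp Z by rewrite inE -!(perpC _ P) YP.
have QC : Q \in perp Y :&: perp Z by rewrite inE -!(perpC _ Q) YQ.
have nQP : Q != P by apply: contraNneq nPQ => ->; exact: perp_refl.
rewrite (cardsD1 P) PC (cardsD1 Q) in_setD1 QC nQP => -[<-].
apply: eq_card => X; rewrite !in_setI !in_setD !in_set1 in_setT in_setU.
rewrite andbT -andbA negb_or.
case XC: (X \in perp Y :&: perp Z); move: (XC); rewrite in_setI.
  move=> /andP[-> ->]; rewrite !andbT andbC; congr (_ && _).
    apply/idP/idP; first by apply: contraNneq => ->; exact: perp_refl.
    by move=> n; apply: (centres_noncollinear hYZ).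
  apply/idP/idP; first by apply: contraNneq => ->; exact: perp_refl.
  by move=> n; apply: (centres_noncollinear hYZ).
by move/negbT/negbTE->; rewrite !andbF.
Qed.

End Quadrangle.

(** * Triads and m-ovoids in order (s, s^2) *)

Section SquareOrder.

Variables (G : incidence) (s : nat).
Hypotheses (s_gt0 : 0 < s) (hG : generalised_quadrangle G s (s ^ 2)).

Implicit Types (P Q X Y Z : point G) (A C : {set point G}).

Lemma sqr_pred n : (n.+1 ^ 2).-1 = n * n.+2.
Proof. lia. Qed.

(** Zero variance: with [W] the points collinear with neither [P] nor [Q] and
    [c R] the number of centres of [P, Q, R], the cardinal of [W] and the sums
    of [c] and [c ^ 2] over [W] satisfy
    [\sum (c ^ 2 + (s + 1) ^ 2) = \sum 2 * (c * (s + 1))],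
    which is the equality case of the termwise inequality [nat_Cauchy]. *)
Lemma triad_centres P Q X : P \notin perp Q ->
  X \notin perp P -> X \notin perp Q ->
  #|perp P :&: perp Q :&: perp X| = s.+1.
Proof.
move=> nPQ XP XQ; set C := perp P :&: perp Q.
pose W := [set: point G] :\: (perp P :|: perp Q).
pose c R := #|C :&: perp R|.
have hT := points_ovoid hG.
have cC : #|C| = (s ^ 2).+1 := centres_card hG nPQ.
have farY Y : Y \in C -> #|W :&: perp Y| = (s ^ 2).-1 * s.
  by move=> YC; rewrite (ovoid_far2_card hG nPQ hT YC) in_setT subn1.
have cW : #|W| = (s * s.-1) * (s ^ 2).+1.
  have := card_far2 P Q [set: point G].
  rewrite !(ovoid_perp_card hG _ hT) (ovoid_card hG P hT) !setTI cC !in_setT -/W.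
  by case: (s) s_gt0 => // n _; nia.
have sum1 : \sum_(R in W) c R = (s ^ 2).+1 * ((s ^ 2).-1 * s).
  rewrite -[LHS](double_count hG) -cC -sum_nat_const; exact: eq_bigr.
have sum2 : \sum_(R in W) c R ^ 2 =
    (s ^ 2).+1 * ((s ^ 2).-1 * s + s ^ 2 * (s ^ 2).-1).
  (* c R ^ 2 counts the pairs of centres of P, Q, R, so exchange the order of
     summation; the diagonal and off-diagonal pairs are counted separately. *)
  transitivity (\sum_(Y in C) \sum_(Z in C) #|W :&: perp Y :&: perp Z|).
    under [RHS]eq_bigr do rewrite (double_count hG).
    rewrite (eq_bigr (fun R => \sum_(Y in C) (Y \in perp R) * c R)).
      rewrite exchange_big; apply: eq_bigr => Y _ /=.
      rewrite [RHS]big_mkcond [LHS]big_mkcond; apply: eq_bigr => R _.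
      rewrite in_setI -(perpC hG R).
      by case: (R \in W); case: (R \in perp Y); rewrite ?mul1n.
    move=> R _; rewrite -big_distrl /= expnS expn1 {1}/c; congr (_ * _).
    exact: card_setI_sum.
  rewrite -cC -sum_nat_const; apply: eq_bigr => Y YC.
  rewrite (bigD1 Y) //= -setIA setIid farY //; congr (_ + _).
  rewrite (eq_bigr (fun=> (s ^ 2).-1)) => [|Z /andP[ZC nZY]].
    rewrite sum_nat_cond_const; congr (_ * _).
    have := cardsD1 Y C; rewrite YC cC => -[->].
    by apply: eq_card => Z; rewrite !inE andbC.
  by apply: (centres_far2_card hG nPQ YC ZC); rewrite eq_sym.
have XW : X \in W by rewrite !in_setD in_setU negb_or XP XQ in_setT.
have := leqif_sum (fun R (_ : R \in W) => nat_Cauchy (c R) s.+1).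
rewrite [X in _ <= X ?= iff _]big_split /= sum2 sum_nat_const cW.
rewrite -[X in X <= _ ?= iff _]big_distrr -big_distrl /= sum1 => -[_].
have -> : 2 * ((s ^ 2).+1 * ((s ^ 2).-1 * s) * s.+1) =
   (s ^ 2).+1 * ((s ^ 2).-1 * s + s ^ 2 * (s ^ 2).-1)
   + s * s.-1 * (s ^ 2).+1 * s.+1 ^ 2.
  by case: (s) s_gt0 => // n _; rewrite sqr_pred /=; lia.
by rewrite eqxx => /esym/forall_inP/(_ X XW)/eqP.
Qed.

(** The collinear pairs between the points of [A] far from [P] and [Q] and the
    common neighbours of [P] and [Q], counted both ways, give a linear equation
    for the number of common neighbours in [A]. *)
Lemma ovoid_centres_card m A P Q : m_ovoid m A -> P \in A -> Q \in A ->
  P \notin perp Q ->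
  #|A :&: (perp P :&: perp Q)| + 2 * s = m * s.+1.
Proof.
move=> hA PA QA nPQ; have m0 := ovoid_gt0 hG hA PA.
have E := double_count hG (A :\: (perp P :|: perp Q)) (perp P :&: perp Q).
rewrite [RHS](eq_bigr (fun=> s.+1)) ?sum_nat_const in E => [|X]; last first.
  rewrite in_setD in_setU negb_or => /andP[/andP[XP XQ] _].
  exact: triad_centres.
have := sum_ovoid hG (perp P :&: perp Q) (s ^ 2).-1 hA.
under eq_bigr => Y YC do rewrite -(ovoid_far2_card hG nPQ hA YC).
rewrite E (centres_card hG nPQ).
have := card_far2 P Q A.
rewrite !(ovoid_perp_card hG _ hA) (ovoid_card hG P hA) PA QA.
move: #|_ :\: _| #|_ :&: _| => w k.
case: (s) s_gt0 => // n _; case: (m) m0 => // p _; rewrite sqr_pred !subSS !subn0.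
(* With s = n + 1 and m = p + 1, the common factor s + 1 of Ec is cancelled
   first; eliminating w then leaves s times the claim. *)
move=> Ew Ec; have {}Ec : w + n * k = n * ((n.+1 ^ 2).+1 * p.+1).
  by apply/eqP; rewrite -(eqn_pmul2l (ltn0Sn n.+1)); apply/eqP; lia.
by apply/eqP; rewrite -(eqn_pmul2l (ltn0Sn n)); apply/eqP; lia.
Qed.

(** Counts the collinear pairs [(Y, Q)] of points of [A], both distinct from
    [P], with [Y] collinear with [P] and [Q] not.  Each [Y] is in
    [s ^ 2 * (m - 1)] such pairs, each [Q] in [m * (s + 1) - 2 * s] of them. *)
Lemma ovoid_eq_half m A P : m_ovoid m A -> P \in A -> m < s.+1 -> m.*2 = s.+1.
Proof.
move=> hA PA ltm; have m0 := ovoid_gt0 hG hA PA.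
have E := double_count hG (A :\: perp P) (A :&: perp P :\ P).
rewrite [LHS](eq_bigr (fun=> s ^ 2 * m.-1)) ?sum_nat_const in E; last first.
  move=> Y; rewrite in_setD1 in_setI => /and3P[nYP YA YP].
  by rewrite (ovoid_far_card hG hA YP nYP) YA subn1.
have K : \sum_(Q in A :\: perp P) #|(A :&: perp P :\ P) :&: perp Q|
    + #|A :\: perp P| * (2 * s) = #|A :\: perp P| * (m * s.+1).
  rewrite -!sum_nat_const -big_split; apply: eq_bigr => Q /=.
  rewrite in_setD => /andP[QP QA].
  have PQ : P \notin perp Q by rewrite (perpC hG).
  rewrite -(ovoid_centres_card hA PA QA PQ); congr (_ + _); apply: eq_card => Y.
  rewrite !in_setI in_setD1 in_setI; case: eqP => [->|_]; last first.
    by rewrite /= andbA.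
  by rewrite (negbTE PQ) !andbF.
rewrite -E {E} in K.
have cP := ovoid_perp_card hG P hA; rewrite PA in cP.
have := cardsID (perp P) A; rewrite (ovoid_card hG P hA) cP.
have := cardsD1 P (A :&: perp P); rewrite in_setI PA perp_refl cP.
move: K; set u := #|_ :&: _ :\ _|; set v := #|A :\: perp P|.
(* As m = n + 1 and s + 1 = m + (e + 1), the factor m - (s + 1) of the final
   equation becomes - (e + 1), and 2 * m - (s + 1) becomes n - e. *)
have [e Es] : exists e, s = m + e by exists (s - m); rewrite subnKC.
rewrite Es; case: (m) m0 => // n _.
rewrite subn1 /= => K Eu Ev.
have {}Eu : u = ((n.+1 + e) ^ 2).+1 * n by lia.
have {}Ev : v = (n.+1 + e) ^ 2 * (n.+1 * (n + e)).+1 by lia.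
have {u v Eu Ev}K : ((n.+1 + e) ^ 2).+1 * n * n
    + (n.+1 * (n + e)).+1 * (2 * (n.+1 + e))
    = (n.+1 * (n + e)).+1 * (n.+1 * (n.+1 + e).+1).
  have s2 : 0 < (n.+1 + e) ^ 2 by rewrite expn_gt0.
  apply/eqP; rewrite -(eqn_pmul2l s2); apply/eqP.
  by move: K; rewrite Eu Ev; lia.
suff -> : e = n by lia.
by apply/eqP; rewrite -(eqn_pmul2l (ltn0Sn e)); apply/eqP; lia.
Qed.

End SquareOrder.

Theorem theorem5p3 (G : incidence) (s : nat) (hs : 2 <= s)
    (hG : generalised_quadrangle G s (s ^ 2)) (P : point G)
    (m : nat) (I : {set point G}) (hI : m_ovoid m I)
    (hm : 0 < m < s.+1)
    (hint : intriguing (trace_perp P I)) :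
  hemisystem s I /\ m.*2 = s.+1.
Proof.
(* As m > 0, the set I has a point X around which to count. *)
case/andP: hm => m_gt0 m_lt; have s_gt0 : 0 < s by apply: ltnW.
have /perpP : P \in perp P := perp_refl P.
case/(_ _ _ hG)=> l _ _.
have /card_gt0P[X] : 0 < #|I :&: points_on l| by rewrite hI.
rewrite inE => /andP[XI _].
have m2 := ovoid_eq_half s_gt0 hG hI XI m_lt.
by split=> //; exists m.
Qed.
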